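(* The function $\|\cdot\|_\oplus:\mathbb{D}_\oplus\to[0,+\infty)$, $\|\mathbf{x}\|_\oplus=\sqrt{\mathcal{A}(\mathbf{x})+\mathcal{B}(\mathbf{x})}$, is a norm (on the real vector space $\mathbb{D}_\oplus$).
   Context: Elements of $\mathbb{R}^4$ are written $\mathbf{x}=(X_{\mathbf{1}},X_{\mathbf{i}},X_{\mathbf{j}},X_{\mathbf{k}})$, with the standard real vector space structure. Put $\mathcal{A}(\mathbf{x})=X_{\mathbf{1}}^2+X_{\mathbf{i}}^2+X_{\mathbf{j}}^2+X_{\mathbf{k}}^2$ and $\mathcal{B}(\mathbf{x})=\sqrt2\,(X_{\mathbf{1}}X_{\mathbf{i}}+X_{\mathbf{i}}X_{\mathbf{j}}+X_{\mathbf{j}}X_{\mathbf{k}}-X_{\mathbf{k}}X_{\mathbf{1}})$, and define $\mathbb{D}_\oplus=\{\mathbf{x}\in\mathbb{R}^4:\mathcal{A}(\mathbf{x})-\mathcal{B}(\mathbf{x})=0\}$, which is a linear subspace of $\mathbb{R}^4$. *)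

(* Defs.v *)
From HB Require Import structures.
From mathcomp Require Import all_boot all_order all_algebra.
From mathcomp Require Import reals.
From mathcomp Require Import ring.

Set Implicit Arguments.
Unset Strict Implicit.
Unset Printing Implicit Defensive.
Import Order.TTheory GRing.Theory Num.Theory.
Local Open Scope ring_scope.

(* The coordinates of x = (X_1, X_i, X_j, X_k) are numbered 0, 1, 2, 3. *)
Definition X1 (R : realType) (x : 'rV[R]_4) : R := x 0 0.
Definition Xi (R : realType) (x : 'rV[R]_4) : R := x 0 1.
Definition Xj (R : realType) (x : 'rV[R]_4) : R := x 0 2.
Definition Xk (R : realType) (x : 'rV[R]_4) : R := x 0 3.

Definition calA (R : realType) (x : 'rV[R]_4) : R :=
  X1 x ^+ 2 + Xi x ^+ 2 + Xj x ^+ 2 + Xk x ^+ 2.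

Definition calB (R : realType) (x : 'rV[R]_4) : R :=
  Num.sqrt 2 * (X1 x * Xi x + Xi x * Xj x + Xj x * Xk x - Xk x * X1 x).

Definition Dplus_pred (R : realType) : {pred 'rV[R]_4} :=
  [pred x | calA x - calB x == 0].
Arguments Dplus_pred : clear implicits.

Lemma calAB_sqr (R : realType) (x : 'rV[R]_4) :
  calA x - calB x =
    (X1 x - Num.sqrt 2 / 2 * (Xi x - Xk x)) ^+ 2 +
    (Xj x - Num.sqrt 2 / 2 * (Xi x + Xk x)) ^+ 2.
Proof.
have h : Num.sqrt 2 * Num.sqrt 2 = 2 :> R by rewrite -expr2 sqr_sqrtr.
rewrite /calA /calB; set s := Num.sqrt 2 in h *.
by field: h.
Qed.

Lemma Dplus_predP (R : realType) (x : 'rV[R]_4) :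
  reflect (X1 x = Num.sqrt 2 / 2 * (Xi x - Xk x) /\
           Xj x = Num.sqrt 2 / 2 * (Xi x + Xk x))
          (x \in Dplus_pred R).
Proof.
rewrite inE calAB_sqr paddr_eq0 ?sqr_ge0// !sqrf_eq0 !subr_eq0.
by apply: (iffP andP) => -[/eqP ? /eqP ?].
Qed.

Lemma Dplus_submod_closed (R : realType) : submod_closed (Dplus_pred R).
Proof.
split=> [|a x y /Dplus_predP[x1 xj] /Dplus_predP[y1 yj]]; apply/Dplus_predP.
  by rewrite /X1 /Xi /Xj /Xk !mxE subrr addr0 mulr0.
move: x1 xj y1 yj; rewrite /X1 /Xi /Xj /Xk !mxE => -> -> -> ->.
by split; ring.
Qed.

HB.instance Definition _ (R : realType) :=
  GRing.isSubmodClosed.Build R 'rV[R]_4 (Dplus_pred R) (@Dplus_submod_closed R).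

Record Dplus (R : realType) := MkDplus {
  Dplus_val :> 'rV[R]_4;
  _ : Dplus_val \in Dplus_pred R }.

HB.instance Definition _ (R : realType) := [isSub for @Dplus_val R].
HB.instance Definition _ (R : realType) := [Choice of Dplus R by <:].
HB.instance Definition _ (R : realType) := [SubChoice_isSubLmodule of Dplus R by <:].

(* Stated for a bare function, whereas the library only has norms as part of a
   structure (normedModType); the last three fields are those of the factory
   Lmodule_isNormed. *)
Record is_norm (R : realType) (V : lmodType R) (N : V -> R) : Prop := IsNorm {
  norm_nonneg : forall x : V, 0 <= N x;
  norm_definite : forall x : V, N x = 0 -> x = 0;
  norm_homogeneous : forall (a : R) (x : V), N (a *: x) = `|a| * N x;
  norm_triangle : forall x y : V, N (x + y) <= N x + N y }.

(* Num.sqrt is total, with value 0 on negative numbers: the definition does not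
   by itself say that the radicand is nonnegative on D_(+). *)
Definition norm_oplus (R : realType) (x : Dplus R) : R :=
  Num.sqrt (calA x + calB x).

(* Main.v *)
(* On D_(+) the coordinates X_1 and X_j are a linear isometric image of X_i and
   X_k, so A = B = 2 (X_i^2 + X_k^2), and the function is twice the Euclidean
   norm of the point (X_i, X_k) of the plane. *)
Require Import Defs.
From mathcomp Require Import all_boot all_order all_algebra.
From mathcomp Require Import reals.
From mathcomp Require Import ring lra.
Import Order.TTheory GRing.Theory Num.Theory.
Local Open Scope ring_scope.

(** Minkowski's inequality in the plane: after squaring, only the cross term remains to be bounded,
    which is Cauchy-Schwarz. *)
Lemma sqrtr_sqrD_triangle (R : rcfType) (a b c d : R) :
  Num.sqrt ((a + c) ^+ 2 + (b + d) ^+ 2) <=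
  Num.sqrt (a ^+ 2 + b ^+ 2) + Num.sqrt (c ^+ 2 + d ^+ 2).
Proof.
have sq_ge0 (u v : R) : 0 <= u ^+ 2 + v ^+ 2 by rewrite addr_ge0 ?sqr_ge0.
have cauchy_schwarz :
    a * c + b * d <= Num.sqrt (a ^+ 2 + b ^+ 2) * Num.sqrt (c ^+ 2 + d ^+ 2).
  rewrite -sqrtrM // (le_trans (ler_norm _)) // -sqrtr_sqr ler_wsqrtr //.
  (* Lagrange's identity: [(a^2 + b^2)(c^2 + d^2) - (ac + bd)^2 = (ad - bc)^2]. *)
  rewrite -subr_ge0; have := sqr_ge0 (a * d - b * c).
  by congr (0 <= _); ring.
rewrite -[leRHS]ger0_norm ?addr_ge0 ?sqrtr_ge0 // -sqrtr_sqr ler_wsqrtr //.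
rewrite [leRHS]sqrrD !sqr_sqrtr //.
move: cauchy_schwarz; lra.
Qed.

Lemma Dplus_calAB (R : realType) (x : Dplus R) :
  calA x + calB x = 2 ^+ 2 * (Xi x ^+ 2 + Xk x ^+ 2).
Proof.
have xD : (x : 'rV[R]_4) \in Dplus_pred R := valP x.
have s2 : Num.sqrt 2 * Num.sqrt 2 = 2 :> R by rewrite -expr2 sqr_sqrtr.
have -> : calB x = calA x.
  by move: xD; rewrite inE subr_eq0 => /eqP ->.
have [x1 xj] := Dplus_predP _ xD.
rewrite /calA x1 xj; set s := Num.sqrt 2 in s2 *.
(* The radicand is now twice [calA x]; expanding with [s * s = 2], the cross terms in [Xi x * Xk x]
   cancel. *)
by field: s2.
Qed.

Lemma norm_oplusE (R : realType) (x : Dplus R) :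
  norm_oplus x = 2 * Num.sqrt (Xi x ^+ 2 + Xk x ^+ 2).
Proof.
by rewrite /norm_oplus Dplus_calAB sqrtrM ?sqr_ge0 // sqrtr_sqr ger0_norm.
Qed.

Theorem theorem12 (R : realType) :
  (forall x : Dplus R, 0 <= calA x + calB x) /\
  is_norm (@norm_oplus R).
Proof.
split=> [x|]; first by rewrite Dplus_calAB mulr_ge0 ?sqr_ge0 ?addr_ge0 ?sqr_ge0.
split=> [x|x|a x|x y].
- exact: sqrtr_ge0.
- rewrite norm_oplusE => /eqP; rewrite mulf_eq0 pnatr_eq0 /= sqrtr_eq0 => le0.
  have : Xi x ^+ 2 + Xk x ^+ 2 == 0 by rewrite eq_le le0 addr_ge0 ?sqr_ge0.
  rewrite paddr_eq0 ?sqr_ge0 // !sqrf_eq0 => /andP[/eqP xi /eqP xk].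
  (* The equations of the subspace express the other two coordinates through [Xi x] and [Xk x], so
     they vanish too. *)
  have [] := Dplus_predP _ (valP x).
  rewrite xi xk subr0 addr0 mulr0 => x1 xj.
  apply/val_inj/rowP => i; rewrite [RHS]mxE.
  case: i => [[|[|[|[|//]]]] lt_i4].
  (* The index from the case split and the numeral in [X1] are ordinals with the same value but
     different bound proofs, hence [val_inj]. *)
  + by rewrite -[RHS]x1; congr (_ _ _); apply/val_inj.
  + by rewrite -[RHS]xi; congr (_ _ _); apply/val_inj.
  + by rewrite -[RHS]xj; congr (_ _ _); apply/val_inj.
  + by rewrite -[RHS]xk; congr (_ _ _); apply/val_inj.
- rewrite !norm_oplusE /Xi /Xk !mxE !exprMn -mulrDr sqrtrM ?sqr_ge0 //.
  by rewrite sqrtr_sqr mulrCA.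
- rewrite !norm_oplusE -mulrDr ler_pM2l // /Xi /Xk !mxE.
  exact: sqrtr_sqrD_triangle.
Qed.
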